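(* There is a constant $C \ge 4$ such that $\mathrm{Sun}(p,k) \le (C p \log k)^k$ for all integers $p,k \ge 2$.
   Context: A sunflower with $p$ petals is a family of $p$ sets whose pairwise intersections are all identical (the common intersection may be empty). $\mathrm{Sun}(p,k)$ denotes the smallest natural number $s$ such that any family of at least $s$ distinct $k$-element sets contains a sunflower with $p$ petals. $\log$ denotes the natural logarithm. *)

(* Defs.v *)
From mathcomp Require Import all_boot all_order all_algebra.
From mathcomp Require Import finmap.
From mathcomp Require Import boolp reals exp.

Set Implicit Arguments.
Unset Strict Implicit.
Unset Printing Implicit Defensive.

Local Open Scope fset_scope.

Definition sunflower (T : choiceType) (p : nat) (S : {fset {fset T}}) : Prop :=
  #|` S| = p /\
  forall A B A' B' : {fset T},
    A \in S -> B \in S -> A' \in S -> B' \in S -> A != B -> A' != B' ->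
    A `&` B = A' `&` B'.

(* Finite families suffice: an infinite family has finite subfamilies of every
   size. *)
Definition forces_sunflower (p k s : nat) : Prop :=
  forall (T : choiceType) (F : {fset {fset T}}),
    (forall A, A \in F -> #|` A| = k) -> s <= #|` F| ->
    exists2 S : {fset {fset T}}, S `<=` F & sunflower p S.

Section ErdosRado.
Variable T : choiceType.
Implicit Types (F S : {fset {fset T}}) (A B U : {fset T}).

Lemma disjoint_or_cover k p F :
  (forall A, A \in F -> #|` A| = k.+1) ->
  (exists S U, [/\ S `<=` F, #|` S| = p, #|` U| <= p * k.+1,
     forall A, A \in S -> A `<=` U &
     forall A B, A \in S -> B \in S -> A != B -> A `&` B = fset0]) \/
  (exists2 U, #|` U| <= p * k.+1 & forall A, A \in F -> A `&` U != fset0).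
Proof.
move=> Fk; elim: p => [|p [[S [U [SF Sp Up SU Sd]]]|[U Up FU]]].
- by left; exists fset0, fset0; rewrite fsub0set !cardfs0; split.
- have [FU|] := pselect (forall A, A \in F -> A `&` U != fset0).
    by right; exists U => //; rewrite (leq_trans Up)// leq_mul2r leqnSn orbT.
  move=> /existsNP[A] /not_implyP[AF] /negP; rewrite negbK => /eqP AU0.
  have Adisj B : B \in S -> A `&` B = fset0.
    move=> /SU BU; apply/eqP; rewrite -fsubset0 -AU0; exact: fsetIS.
  have AS : A \notin S.
    apply/negP => /Adisj; rewrite fsetIid => A0.
    by have := Fk _ AF; rewrite A0 cardfs0.
  left; exists (A |` S), (A `|` U); split.
  + by rewrite fsubUset fsub1set AF.
  + by rewrite cardfsU1 AS Sp.
  + rewrite mulSn (leq_trans (leq_card_fsetU _ _))// Fk// leq_add2l//.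
  + move=> B /fset1UP[->|/SU BU]; first exact: fsubsetUl.
    by rewrite (fsubset_trans BU)// fsubsetUr.
  + move=> B B' /fset1UP[->|BS] /fset1UP[->|BS']; first by rewrite eqxx.
    * by move=> _; exact: Adisj.
    * by move=> _; rewrite fsetIC; exact: Adisj.
    * exact: Sd.
- by right; exists U => //; rewrite (leq_trans Up)// leq_mul2r leqnSn orbT.
Qed.

Lemma cover_card (s : nat) (us : seq T) F :
  (forall A, A \in F -> has (fun x => x \in A) us) ->
  (forall x, #|` [fset A in F | x \in A]| <= s) ->
  #|` F| <= size us * s.
Proof.
elim: us F => [|x us IH] F Fus Fs.
  rewrite mul0n leqn0 cardfs_eq0; apply/eqP/fsetP => A; rewrite inE.
  by apply/negP => /Fus.
set G := [fset A in F | x \notin A].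
have FE : F `<=` [fset A in F | x \in A] `|` G.
  by apply/fsubsetP => A AF; rewrite !inE /= AF /=; case: (x \in A).
rewrite mulSn (leq_trans (fsubset_leq_card FE))//.
rewrite (leq_trans (leq_card_fsetU _ _))// leq_add//; apply: IH => [A|y].
  by rewrite !inE /= => /andP[/Fus/= /orP[->|//]].
rewrite (leq_trans _ (Fs y))//; apply: fsubset_leq_card; apply/fsubsetP => A.
by rewrite !inE /= => /andP[/andP[-> _] ->].
Qed.

Lemma sunflower_fset1U p (x : T) S :
  (forall A, A \in S -> x \notin A) -> sunflower p S ->
  sunflower p [fset x |` A | A in S].
Proof.
move=> xS [Sp Sc]; split.
  rewrite card_in_imfset//= => A B AS BS AB.
  by rewrite -(fsetU1K (xS _ AS)) AB fsetU1K// xS.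
move=> ? ? ? ? /imfsetP[A /= AS ->] /imfsetP[B /= BS ->].
move=> /imfsetP[A' /= AS' ->] /imfsetP[B' /= BS' ->] nAB nAB'.
rewrite -!fsetUIr (Sc A B A' B')//.
- by apply: contra nAB => /eqP ->.
- by apply: contra nAB' => /eqP ->.
Qed.

End ErdosRado.

Lemma sunflower_lemma (p k : nat) :
  exists s, forces_sunflower p k s.
Proof.
elim: k => [|k [s IH]].
  exists 2 => T F F0 F2; exfalso; move: F2; apply/negP; rewrite -ltnNge ltnS.
  rewrite -(cardfs1 (fset0 : {fset T})); apply: fsubset_leq_card.
  by apply/fsubsetP => A /F0/eqP; rewrite cardfs_eq0 inE.
exists (p * k.+1 * s).+1 => T F Fk Fs.
have [[S [U [SF Sp _ _ Sd]]]|[U Up FU]] := disjoint_or_cover p Fk.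
  by exists S => //; split=> // A B A' B' ? ? ? ? ? ?; rewrite !Sd.
have [x xs] : exists x, s <= #|` [fset A in F | x \in A]|.
  apply: contrapT => /forallNP H.
  move: Fs; apply/negP; rewrite -leqNgt.
  rewrite (leq_trans (@cover_card _ s U F _ _))//.
  - move=> A /FU /fset0Pn[x]; rewrite inE => /andP[xA xU].
    by apply/hasP; exists x.
  - by move=> x; move/negP: (H x); rewrite -ltnNge => /ltnW.
  - by rewrite leq_mul2r Up orbT.
set Fx := [fset A in F | x \in A] in xs *.
have FxP A : A \in Fx -> A \in F /\ x \in A by rewrite !inE /= => /andP.
have [||S SF Ssun] := IH _ [fset A `\ x | A in Fx].
- move=> ? /imfsetP[A /= /FxP[AF xA] ->].
  by have := cardfsD1 x A; rewrite xA Fk// => -[].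
- rewrite card_in_imfset//= => A B /FxP[_ xA] /FxP[_ xB] AB.
  by rewrite -(fsetD1K xA) AB fsetD1K.
exists [fset x |` A | A in S].
- apply/fsubsetP => ? /imfsetP[A /= /(fsubsetP SF)].
  by move=> /imfsetP[B /= /FxP[BF xB] ->] ->; rewrite fsetD1K.
- apply: sunflower_fset1U => // A /(fsubsetP SF) /imfsetP[B _ ->].
  by rewrite !inE eqxx.
Qed.

Lemma ex_forces_sunflower (p k : nat) :
  exists s, `[< forces_sunflower p k s >].
Proof. by have [s ?] := sunflower_lemma p k; exists s; apply/asboolP. Qed.

Definition Sun (p k : nat) : nat := ex_minn (ex_forces_sunflower p k).

(* Main.v *)
(* Let m be about log2 k and r = 16 p m.  If F has more than r ^ k members, take
   a largest Y for which more than r ^ (k - |Y|) members of F contain Y; the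
   sets A \ Y with Y <= A in F then form a spread family (a proportion at most
   r ^ (- |U|) of them contains a given U), and p disjoint ones form a sunflower
   with kernel Y.

   To find them, colour the points uniformly with 2 p blocks of m colours.  It
   suffices that for each block the points coloured in it contain a member with
   probability above 1/2, since then by averaging some colouring has at least p
   successful blocks (this is what avoids a factor log p).  Within a block, the
   colour classes W are exposed one at a time.  Each current set is replaced by
   its minimal fragment f j \ W, over the f j contained in the union of W and
   the set, and sets whose fragment exceeds half of the current size bound are
   discarded.  To bound the loss, recolour a fragment T with the colour of W:
   T lies in any current set covered by the enlarged class, so the new
   colouring leaves at most 2 ^ k choices for T, after which spreadness bounds
   the number of sets containing T. *)
Require Import Defs.
From mathcomp Require Import all_boot all_order all_algebra.
From mathcomp Require Import finmap.
From mathcomp Require Import boolp reals exp zify lra.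
Import Order.TTheory GRing.Theory Num.Theory.
Local Open Scope nat_scope.

Set Implicit Arguments.
Unset Strict Implicit.
Unset Printing Implicit Defensive.

(** * Recolouring a set of points *)

Definition recolor (X K : finType) (chi : {ffun X -> K}) (U : {set X}) (c : K)
    : {ffun X -> K} :=
  [ffun x => if x \in U then c else chi x].

(** The colouring [psi] determines [chi] outside [U], so only the colours on [U] are free. *)
Lemma card_recolor_fiber (X K : finType) (U : {set X}) (c : K)
    (psi : {ffun X -> K}) :
  #|[set chi | recolor chi U c == psi]| <= #|K| ^ #|U|.
Proof.
pose F x := if x \in U then predT else pred1 (psi x).
have -> : #|K| ^ #|U| = #|family F|.
  rewrite card_family foldrE big_image /= (bigID (mem U)) /=.
  rewrite -prod_nat_const [X in _ = _ * X]big1 ?muln1.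
    by apply: eq_bigr => x xU; rewrite /F xU.
  by move=> x /negbTE xU; rewrite /F xU card1.
apply: subset_leq_card; apply/subsetP => chi; rewrite inE => /eqP E.
apply/familyP => x; rewrite /F; case: ifP => // xU.
by rewrite inE -E ffunE xU.
Qed.

(** * Minimal fragments and their iteration *)

Section Fragments.
Variables (X I K : finType).
Implicit Types (c : K) (g : {ffun I -> {set X}}) (chi psi : {ffun X -> K})
  (a : {set I}) (W : {set X}).

Definition coloured chi c : {set X} := [set x | chi x == c].

(** The default [i] is itself a candidate when [i \in a]; the minimiser may be another index. *)
Definition fragment g a W (i : I) : {set X} :=
  g [arg min_(j < i | (j \in a) && (g j \subset W :|: g i)) #|g j :\: W|] :\: W.

Lemma fragmentP g a W i : i \in a ->
  exists j, [/\ j \in a, g j \subset W :|: g i, fragment g a W i = g j :\: W &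
    forall j', j' \in a -> g j' \subset W :|: g i ->
      #|fragment g a W i| <= #|g j' :\: W|].
Proof.
move=> ia; rewrite /fragment; case: arg_minnP => [|j /andP[ja jW] jmin].
  by rewrite ia subsetUr.
by exists j; split=> // j' j'a j'W; apply: jmin; rewrite j'a j'W.
Qed.

Lemma fragment_sub g a W i : i \in a -> fragment g a W i \subset g i :\: W.
Proof.
move=> /(@fragmentP g a W)[j [_ jW -> _]].
apply/subsetP => x; rewrite !inE => /andP[xW /(subsetP jW)].
by rewrite inE (negbTE xW).
Qed.

(* The family at a given stage depends only on the colour classes already
   exposed, which its sets avoid: it is unaffected by giving part of one of its
   sets a colour still to be exposed. *)
Definition stable (cs : {pred K}) (f : {ffun X -> K} -> {ffun I -> {set X}})
    (a : {ffun X -> K} -> {set I}) : Prop :=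
  forall c chi i (U : {set X}), c \in cs -> i \in a chi -> U \subset f chi i ->
    f (recolor chi U c) = f chi /\ a (recolor chi U c) = a chi.

Variables (S : I -> {set X}) (f : {ffun X -> K} -> {ffun I -> {set X}})
  (a : {ffun X -> K} -> {set I}).
Hypothesis fS : forall chi i, i \in a chi -> f chi i \subset S i.

Let frag c chi i := fragment (f chi) (a chi) (coloured chi c) i.

Lemma coloured_recolor chi (U : {set X}) c :
  coloured (recolor chi U c) c = coloured chi c :|: U.
Proof.
apply/setP => x; rewrite !inE ffunE; case: (x \in U); first by rewrite eqxx orbT.
by rewrite orbF.
Qed.

Lemma coloured_recolor_neq chi (U : {set X}) c d :
  d != c -> [disjoint U & coloured chi c] ->
  coloured (recolor chi U d) c = coloured chi c.
Proof.
move=> dc dis; apply/setP => x; rewrite !inE ffunE; case: ifP => // xU.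
by have := disjointFr dis xU; rewrite inE (negbTE dc) => ->.
Qed.

(** A fragment avoids the class of [c], so giving part of it a colour [d != c] changes neither that
    class nor the previous family. *)
Lemma stable_fragment c (cs : {pred K}) (P : {set X} -> bool) :
  c \notin cs -> stable cs f a ->
  stable cs (fun chi => [ffun i => frag c chi i])
    (fun chi => [set i in a chi | P (frag c chi i)]).
Proof.
move=> ccs st d chi i U dcs; rewrite inE ffunE => /andP[ia _] Ufrag.
have Uf : U \subset f chi i :\: coloured chi c.
  exact: subset_trans Ufrag (fragment_sub _ _ ia).
have [Ef Ea] := st _ _ _ _ dcs ia (subset_trans Uf (subsetDl _ _)).
have dc : d != c by apply: contraNneq ccs => <-.
have dis : [disjoint U & coloured chi c].
  by move: Uf; rewrite subsetD => /andP[].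
have EF : frag c (recolor chi U d) =1 frag c chi.
  by move=> j; rewrite /frag Ef Ea coloured_recolor_neq.
split; first by apply/ffunP => j; rewrite !ffunE EF.
by apply/setP => j; rewrite !inE Ea EF.
Qed.

(* A member of the family covered by the enlarged colour class of [psi]: it
   contains every fragment whose recolouring yields [psi], which is what makes
   the number of possible fragments at most [2 ^ k]. *)
Definition covered psi c : {set X} :=
  if [pick j | (j \in a psi) && (f psi j \subset coloured psi c)] is Some j
  then f psi j else set0.

(** Write [W] for the class of [c] and [T] for the fragment. A set [f chi j'] inside [W :|: T] also
    lies inside [W :|: f chi i], so it competes in the minimum defining [T]; as its part outside [W]
    lies in [T], it equals [T]. *)
Lemma fragment_sub_covered c chi i :
  stable (pred1 c) f a -> i \in a chi ->
  frag c chi i \subset covered (recolor chi (frag c chi i) c) c.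
Proof.
move=> st ia; set T := frag c chi i; set psi := recolor chi T c.
have TD : T \subset f chi i :\: coloured chi c by exact: fragment_sub.
have Tf := subset_trans TD (subsetDl _ _).
have [Ef Ea] := st c chi i T (eqxx c) ia Tf.
rewrite /covered Ef Ea coloured_recolor.
have [j [ja jW TE Tmin]] := @fragmentP (f chi) (a chi) (coloured chi c) i ia.
case: pickP => [j' /andP[j'a j'W]|/(_ j)]; last first.
  by rewrite ja /T /frag TE -subDset subxx.
have DT : f chi j' :\: coloured chi c \subset T.
  by rewrite subDset.
have : T = f chi j' :\: coloured chi c.
  apply/esym/eqP; rewrite eqEcard DT Tmin //.
  by apply: subset_trans j'W _; rewrite setUS.
by move=> ->; rewrite subsetDl.
Qed.

(** Map a bad pair to its recoloured colouring and its fragment [T]. Given the former, [T] has at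
    most [2 ^ k] values; given both, at most [#|K| ^ #|T|] colourings and, by spreadness,
    [#|I| / (rho * #|K|) ^ #|T|] indices remain. The net gain is [rho ^ #|T|]. *)
Lemma bad_fragments (k l rho : nat) c :
  0 < rho ->
  (forall chi i, i \in a chi -> #|f chi i| <= k) ->
  (forall U : {set X},
     #|[set i | U \subset S i]| * (rho * #|K|) ^ #|U| <= #|I|) ->
  stable (pred1 c) f a ->
  #|[set b : {ffun X -> K} * I | (b.2 \in a b.1) && (l < #|frag c b.1 b.2|)]|
    * rho ^ l.+1 <= #|{ffun X -> K}| * 2 ^ k * #|I|.
Proof.
move=> rho0 fk spread st.
set B := [set _ | _].
pose h (b : {ffun X -> K} * I) :=
  (recolor b.1 (frag c b.1 b.2) c, frag c b.1 b.2).
pose Q (y : {ffun X -> K} * {set X}) := (y.2 \subset covered y.1 c) && (l < #|y.2|).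
rewrite -sum1_card (partition_big h Q) /=; last first.
  move=> [chi i]; rewrite inE /= => /andP[ia lt].
  by rewrite /Q /= lt andbT fragment_sub_covered.
rewrite big_distrl /=.
apply: (@leq_trans (\sum_(y | Q y) #|I|)).
  apply: leq_sum => -[psi T] /andP[/= _ lT].
  apply: leq_trans (spread T); rewrite expnMn [_ ^ _ * _]mulnC mulnA.
  apply: leq_mul; last by rewrite leq_pexp2l.
  rewrite mulnC; apply: leq_trans (leq_mul (card_recolor_fiber T c psi) (leqnn _)).
  rewrite -cardsX sum1dep_card; apply: subset_leq_card.
  apply/subsetP => -[chi i]; rewrite !inE /= xpair_eqE.
  move=> /andP[/andP[ia _] /andP[/eqP h1 /eqP h2]].
  rewrite -h2 h1 h2 eqxx /= -h2.
  apply: subset_trans (fS ia).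
  exact: subset_trans (fragment_sub _ _ ia) (subsetDl _ _).
rewrite sum_nat_const leq_mul2r; apply/orP; right.
rewrite -sum1_card; under eq_bigl do rewrite unfold_in.
rewrite -(pair_big_dep xpredT (fun psi T => Q (psi, T)) (fun _ _ => 1)) /=.
rewrite -sum_nat_const; apply: leq_sum => psi _; rewrite sum1dep_card.
apply: (@leq_trans #|powerset (covered psi c)|).
  by apply: subset_leq_card; apply/subsetP => T; rewrite !inE => /andP[].
rewrite card_powerset leq_pexp2l // /covered.
by case: pickP => [j /andP[ja _]|_]; [exact: fk | rewrite cards0].
Qed.

End Fragments.

(* With D the number of pairs (colouring, index), dividing by [2 ^ k.+1 * D]
   reads: the proportion of alive pairs is at most the proportion of good
   colourings plus [2^-1 - 2 ^- k.+1], a bound that is inductive under halving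
   [k]. *)
Lemma iterated_fragments (X I K : finType) (S : I -> {set X}) (cs : seq K) :
  (forall U : {set X},
     #|[set i | U \subset S i]| * (8 * #|K|) ^ #|U| <= #|I|) ->
  uniq cs ->
  forall (k : nat) (f : {ffun X -> K} -> {ffun I -> {set X}})
         (a : {ffun X -> K} -> {set I}),
  k < 2 ^ size cs ->
  (forall chi i, i \in a chi -> f chi i \subset S i) ->
  (forall chi i, i \in a chi -> #|f chi i| <= k) ->
  stable (mem cs) f a ->
  2 ^ k.+1 * \sum_chi #|a chi| <=
    2 ^ k.+1 * #|I|
      * #|[set chi : {ffun X -> K} | [exists i in a chi, f chi i \subset [set x | chi x \in cs]]]|
    + (2 ^ k).-1 * (#|{ffun X -> K}| * #|I|).
Proof.
move=> spread; set N := #|I|; set D := #|_| * N.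
have base k (f : {ffun X -> K} -> {ffun I -> {set X}})
    (a : {ffun X -> K} -> {set I}) (cs' : seq K) :
    (forall chi i, i \in a chi -> #|f chi i| <= k) -> k = 0 ->
  2 ^ k.+1 * \sum_chi #|a chi| <=
    2 ^ k.+1 * N
      * #|[set chi : {ffun X -> K} | [exists i in a chi, f chi i \subset [set x | chi x \in cs']]]|
    + (2 ^ k).-1 * D.
  (* Alive sets are empty here, so every colouring with an alive index is good. *)
  move=> fk k0; rewrite {k}k0 in fk *; rewrite mul0n addn0 -mulnA leq_mul2l /=.
  set G := [set _ | _].
  rewrite mulnC -sum_nat_const (bigID (mem G)) /= [X in _ + X]big1 ?addn0.
    by apply: leq_sum => chi _; exact: max_card.
  move=> chi; rewrite inE negb_exists => /forallP aG; apply: eq_card0 => i.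
  apply/negbTE/negP => ia; have := aG i; rewrite ia /=.
  by have := fk _ _ ia; rewrite leqn0 cards_eq0 => /eqP ->; rewrite sub0set.
elim: cs => [_|c cs IH /= /andP[ccs ucs]] k f a.
  by rewrite expn0 ltnS leqn0 => /eqP k0 _ fk _; exact: base.
have [-> _ _ fk _|k_gt0 klt fS fk st] := posnP k; first exact: base.
pose l := k./2.
have k2l : k <= l.*2.+1 by rewrite -[leqLHS]odd_double_half -add1n leq_add2r leq_b1.
have lk : l < k by rewrite /l -divn2 ltn_Pdiv.
have [q q_gt0 kq] : exists2 q, 2 <= q & 2 ^ k = q * 2 ^ l.
  exists (2 ^ (k - l)); last by rewrite -expnD subnK // ltnW.
  by rewrite -{1}(expn1 2) leq_exp2l // subn_gt0.
pose frag chi i := fragment (f chi) (a chi) (coloured chi c) i.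
pose f' chi := [ffun i => frag chi i].
pose a' chi := [set i in a chi | #|frag chi i| <= l].
have fragf chi i : i \in a chi -> frag chi i \subset f chi i.
  by move=> ia; apply: subset_trans (fragment_sub _ _ ia) (subsetDl _ _).
have bad := @bad_fragments X I K S f a fS k l 8 c isT fk spread.
have /bad {bad} : stable (pred1 c) f a.
  by move=> d chi i U /eqP -> ; apply: st; rewrite inE eqxx.
set B := [set _ | _] => badB.
(* The factor [8 ^ l.+1] splits as [2 ^ l.+2 * 2 ^ l.*2.+1], and the second factor absorbs
   [2 ^ k]. *)
have {}badB : #|B| * 2 ^ l.+2 <= D.
  have P : 0 < 2 ^ l.*2.+1 by rewrite expn_gt0.
  rewrite -(leq_pmul2r P) -mulnA -expnD.
  have -> : l.+2 + l.*2.+1 = 3 * l.+1 by lia.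
  rewrite expnM; apply: leq_trans badB _.
  by rewrite /D mulnAC leq_mul2l leq_exp2l // k2l orbT.
have split_alive : \sum_chi #|a chi| <= \sum_chi #|a' chi| + #|B|.
  have -> : #|B| = \sum_chi #|[set i in a chi | l < #|frag chi i|]|.
    rewrite -sum1_card (eq_bigl (fun b : _ * I => xpredT b.1 &&
      ((b.2 \in a b.1) && (l < #|frag b.1 b.2|)))); last by move=> b; rewrite !inE.
    rewrite -(pair_big_dep xpredT
      (fun chi i => (i \in a chi) && (l < #|frag chi i|)) (fun _ _ => 1)) /=.
    by apply: eq_bigr => chi _; rewrite sum1dep_card.
  rewrite -big_split /=; apply: leq_sum => chi _.
  rewrite -(cardsID (a' chi) (a chi)) leq_add //; apply: subset_leq_card.
    exact: subsetIr.
  by apply/subsetP => i; rewrite !inE => /andP[+ ia]; rewrite ia /= ltnNge.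
have IHa : 2 ^ l.+1 * \sum_chi #|a' chi| <= 2 ^ l.+1 * N *
    #|[set chi : {ffun X -> K} | [exists i in a' chi, f' chi i \subset [set x | chi x \in cs]]]|
    + (2 ^ l).-1 * D.
  apply: (IH ucs l f' a').
  - move: klt; rewrite /= expnS; rewrite /l -divn2 ltn_divLR //; lia.
  - move=> chi i; rewrite inE ffunE => /andP[ia _].
    exact: subset_trans (fragf _ _ ia) (fS _ _ ia).
  - by move=> chi i; rewrite inE ffunE => /andP[].
  - apply: (@stable_fragment X I K f a c (mem cs) (fun T => #|T| <= l)) => //.
    by move=> d chi i U dcs; apply: st; rewrite inE dcs orbT.
move: IHa; set G' := #|[set _ | _]|; set G := #|[set _ | _]| => IHa.
(* A fragment of [i] is the rest of some alive [f chi j]: if the later colours cover it, then with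
   [c] they cover [f chi j], though perhaps not [f chi i]. *)
have GG : G' <= G.
  apply: subset_leq_card; apply/subsetP => chi; rewrite !inE.
  move=> /existsP[i /andP[]]; rewrite inE ffunE => /andP[ia _] sub.
  have [j [ja jW fE _]] := @fragmentP _ _ (f chi) _ (coloured chi c) _ ia.
  apply/existsP; exists j; rewrite ja /=; move: sub; rewrite /frag fE.
  move=> /subsetP sub; apply/subsetP => x xj; rewrite !inE.
  by case: eqVneq => //= xc; have := sub x; rewrite !inE xj xc; apply.
have pl : 0 < 2 ^ l by rewrite expn_gt0.
rewrite !expnS kq in badB IHa *.
move: (\sum_chi #|a chi|) (\sum_chi #|a' chi|) split_alive IHa => s s' ss IHa.
have {ss} : 2 * (q * 2 ^ l) * s <= q * (2 * 2 ^ l * s') + q * (2 * 2 ^ l * #|B|).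
  by nia.
move/leq_trans; apply.
have alive' : q * (2 * 2 ^ l * s') <= q * (2 * 2 ^ l * N * G + (2 ^ l).-1 * D).
  rewrite leq_mul2l (leq_trans IHa) ?orbT //.
  by rewrite leq_add2r leq_mul2l GG orbT.
(* By [badB] the left side is at most half of [q * D], and [q <= 2 * q.-1] since [2 <= q]. *)
have dead : q * (2 * 2 ^ l * #|B|) <= q.-1 * D.
  apply: leq_trans (leq_mul (leqnn q.-1) badB).
  have -> : q.-1 * (#|B| * (2 * (2 * 2 ^ l))) = (2 * q.-1) * (2 * 2 ^ l * #|B|).
    by lia.
  by rewrite leq_mul2r; apply/orP; right; lia.
apply: leq_trans (leq_add alive' dead) _.
have -> : (q * 2 ^ l).-1 = q * (2 ^ l).-1 + q.-1 by nia.
by apply: eq_leq; lia.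
Qed.

(** * Disjoint members of a spread family *)

Lemma spread_disjoint (X I : finType) (S : I -> {set X}) (p k : nat) :
  0 < p -> 0 < #|I| -> (forall i, #|S i| <= k) ->
  (forall U : {set X},
    #|[set i | U \subset S i]| * (16 * p * (trunc_log 2 k).+1) ^ #|U| <= #|I|) ->
  exists s : 'I_p -> I, forall j j', j != j' -> [disjoint S (s j) & S (s j')].
Proof.
move=> p_gt0 I_gt0 Sk spread; set m := (trunc_log 2 k).+1 in spread.
pose K := ('I_(2 * p) * 'I_m)%type.
have cardK : #|{: K}| = 2 * p * m by rewrite card_prod !card_ord.
pose cs (j : 'I_(2 * p)) : seq K := [seq (j, i) | i <- enum 'I_m].
have csE j (x : K) : (x \in cs j) = (x.1 == j).
  apply/mapP/eqP => [[i _ ->] //|xj]; exists x.2; rewrite ?mem_enum //.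
  by rewrite -xj; case: (x).
pose good (chi : {ffun X -> K}) j := [exists i, S i \subset [set x | (chi x).1 == j]].
(* A constant family is stable, [m] colours suffice as [k < 2 ^ m], and [16 * p * m] is [8 * #|K|].
   With all pairs alive, the good proportion is at least [2^-1 + 2 ^- k.+1]. *)
have half j : #|{ffun X -> K}| < 2 * #|[set chi | good chi j]|.
  have := @iterated_fragments X I K S (cs j) _ _ k
    (fun _ => [ffun i => S i]) (fun _ => setT).
  rewrite size_map size_enum_ord trunc_log_ltn // cardK.
  rewrite (_ : 8 * (2 * p * m) = 16 * p * m); last by lia.
  rewrite map_inj_uniq ?enum_uniq => [|i i' [] //].
  have H1 (chi : {ffun X -> K}) (i : I) : i \in setT -> [ffun i => S i] i \subset S i.
    by rewrite ffunE.
  have H2 (chi : {ffun X -> K}) (i : I) : i \in setT -> #|[ffun i => S i] i| <= k.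
    by rewrite ffunE.
  move=> /(_ spread isT isT H1 H2) {H1 H2}.
  have st : stable (mem (cs j)) (fun _ => [ffun i => S i]) (fun _ => setT) by [].
  move=> /(_ st) {st}.
  rewrite (_ : [set chi | _] = [set chi | good chi j]); last first.
    apply/setP => chi; rewrite !inE; apply/existsP/existsP => -[i].
      rewrite inE ffunE /= => /subsetP sub; exists i; apply/subsetP => x /sub.
      by rewrite !inE csE.
    move=> /subsetP sub; exists i; rewrite inE ffunE /=; apply/subsetP => x /sub.
    by rewrite !inE csE.
  rewrite sum_nat_const cardsT expnS.
  have := expn_gt0 2 k; move: (2 ^ k) #|[set _ | _]| => u g /= u0.
  have : 0 < #|{ffun X -> K}|.
    by apply/card_gt0P; exists [ffun=> (Ordinal (n := 2 * p) (m := 0) ltac:(lia), ord0)].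
  move: #|{ffun _ -> _}| #|I| I_gt0 => M N N0 M0 le.
  rewrite ltnNge; apply/negP => gM.
  suff : 2 * u * N * g + u.-1 * (M * N) < 2 * u * (M * N) by lia.
  have : 2 * u * N * g <= u * (M * N) by nia.
  nia.
(* Double counting of good pairs of a colouring and a block; the strict inequality in [half]
   excludes fewer than [p] good blocks everywhere. *)
have [chi chip] : exists chi, p <= #|[set j | good chi j]|.
  apply/existsP; apply: contraT; rewrite negb_exists => /forallP few.
  have cardE (Y : finType) (P : pred Y) : #|[set y | P y]| = \sum_y P y.
    by rewrite -sum1dep_card big_mkcond; apply: eq_bigr => y _; case: (P y).
  have count_good : \sum_(j < 2 * p) 2 * #|[set chi | good chi j]| =
                    \sum_chi 2 * #|[set j | good chi j]|.
    rewrite -!big_distrr /=; congr (_ * _).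
    under eq_bigr do rewrite cardE.
    by under [RHS]eq_bigr do rewrite cardE; exact: exchange_big.
  have : \sum_(j < 2 * p) #|{ffun X -> K}|.+1 <=
         \sum_(j < 2 * p) 2 * #|[set chi | good chi j]| by apply: leq_sum => j _.
  have : \sum_chi 2 * #|[set j | good chi j]| <= \sum_(chi : {ffun X -> K}) 2 * p.
    by apply: leq_sum => chi _; rewrite leq_mul2l /= ltnW // ltnNge few.
  rewrite count_good !sum_nat_const card_ord => A B.
  by have := leq_trans B A; rewrite mulnC leq_pmul2r ?ltnn // muln_gt0.
have ex (j : 'I_p) :
    exists i, S i \subset [set x | (chi x).1 == enum_val (widen_ord chip j)].
  by have := enum_valP (widen_ord chip j); rewrite inE => /existsP.
have [s sP] := fin_all_exists ex; exists s => j j' jj'.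
rewrite -setI_eq0; apply/eqP/setP => x; rewrite !inE; apply/negP => /andP[xj xj'].
have := subsetP (sP j) x xj; have := subsetP (sP j') x xj'.
rewrite !inE => /eqP -> /eqP /enum_val_inj /(congr1 val) /= /val_inj E.
by rewrite E eqxx in jj'.
Qed.

(** * From a large uniform family to a spread one *)

Local Open Scope fset_scope.

Definition star (T : choiceType) (F : {fset {fset T}}) (Y : {fset T})
    : {fset {fset T}} :=
  [fset A in F | Y `<=` A].

Lemma starP (T : choiceType) (F : {fset {fset T}}) (Y A : {fset T}) :
  (A \in star F Y) = (A \in F) && (Y `<=` A).
Proof. by rewrite !inE. Qed.

Lemma maximal_star (T : choiceType) (F : {fset {fset T}}) (k r : nat) :
  (forall A, A \in F -> #|` A| = k) -> r ^ k < #|` F| ->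
  exists Y : {fset T}, [/\ #|` Y| < k, r ^ (k - #|` Y|) < #|` star F Y| &
    forall Z : {fset T}, #|` Y| < #|` Z| -> #|` star F Z| <= r ^ (k - #|` Z|)].
Proof.
move=> Fk Fr.
pose large n := `[< exists2 Y : {fset T},
  r ^ (k - #|` Y|) < #|` star F Y| & #|` Y| = n >].
have member (Y : {fset T}) : 0 < #|` star F Y| -> exists2 A, A \in F & Y `<=` A.
  by rewrite cardfs_gt0 => /fset0Pn[A]; rewrite starP => /andP[]; exists A.
have ex_large : exists n, large n.
  exists 0; apply/asboolP; exists fset0; rewrite ?cardfs0 ?subn0 //.
  apply: leq_trans Fr _; apply: fsubset_leq_card; apply/fsubsetP => A AF.
  by rewrite starP AF fsub0set.
have large_le n : large n -> n <= k.
  move=> /asboolP[Y YF <-].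
  have [A AF YA] := member Y (leq_ltn_trans (leq0n _) YF).
  by rewrite -(Fk A AF) fsubset_leq_card.
case: (ex_maxnP ex_large large_le) => _ /asboolP[Y YF <-] Ymax.
exists Y; split=> //; last first.
  move=> Z YZ; rewrite leqNgt; apply/negP => ZF.
  by move: YZ; rewrite ltnNge Ymax //; apply/asboolP; exists Z.
have Yk : #|` Y| <= k by apply: large_le; apply/asboolP; exists Y.
(* If [Y] had [k] elements, its star could contain only [Y], yet it has more than [r ^ 0]
   members. *)
rewrite ltn_neqAle Yk andbT; apply/eqP => YE.
move: YF; rewrite YE subnn expn0 ltnNge -(cardfs1 Y) fsubset_leq_card //.
apply/fsubsetP => A; rewrite starP inE => /andP[AF YA].
by rewrite eq_sym eqEfcard YA Fk // YE leqnn.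
Qed.

Lemma card_set_fset_le (T : choiceType) (U A : {fset T}) (W : {set U}) :
  (forall x, x \in W -> val x \in A) -> #|W| <= #|` A|.
Proof.
move=> WA; rewrite cardE -(size_map val); apply: uniq_leq_size.
  by rewrite map_inj_uniq ?enum_uniq //; exact: val_inj.
by move=> _ /mapP[x + ->]; rewrite mem_enum => /WA.
Qed.

Lemma forces_sunflower_expn (p k : nat) : 0 < p ->
  forces_sunflower p k ((16 * p * (trunc_log 2 k).+1) ^ k).+1.
Proof.
set r := 16 * _ * _ => p_gt0 T F Fk /(maximal_star Fk)[Y [Yk YF Ymax]].
pose U := \bigcup_(A <- F) A.
have FU A : A \in F -> A `<=` U by move=> AF; exact: bigfcup_sup.
pose S (i : star F Y) : {set U} := [set x | val x \in val i `\` Y].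
have iP (i : star F Y) : val i \in F /\ Y `<=` val i.
  by apply/andP; rewrite -starP; exact: valP.
have Sk i : #|S i| <= k.
  rewrite -(Fk (val i)); last by have [] := iP i.
  by apply: card_set_fset_le => x; rewrite !inE => /andP[].
have cardY : #|{: star F Y}| = #|` star F Y| by rewrite cardfE.
have spread (W : {set U}) : #|[set i | W \subset S i]| * r ^ #|W| <= #|{: star F Y}|.
  (* The empty [W] is separate, since maximality bounds only stars of sets larger than [Y]. *)
  have [/eqP|W_gt0] := posnP #|W|.
    by rewrite cards_eq0 => /eqP ->; rewrite cards0 muln1 max_card.
  have [->|[i0]] := set_0Vmem [set i | W \subset S i]; first by rewrite cards0.
  rewrite inE => Wi0.
  pose V : {fset T} := [fset val x | x in W].
  have cardV : #|` V| = #|W|.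
    by rewrite card_imfset /= ?cardE //; exact: val_inj.
  have VP i x : W \subset S i -> x \in V -> (x \notin Y) && (x \in val i).
    by move=> /subsetP WS /imfsetP[y /= /WS + ->]; rewrite !inE.
  have cardYV : #|` Y `|` V| = (#|` Y| + #|W|)%N.
    rewrite -cardV cardfsU (_ : Y `&` V = fset0) ?cardfs0 ?subn0 //.
    apply/fsetP => x; rewrite !inE; apply/negP => /andP[xY].
    by move=> /(VP i0 _ Wi0); rewrite xY.
  have YVi i : W \subset S i -> Y `|` V `<=` val i.
    move=> WS; rewrite fsubUset (iP i).2 /=; apply/fsubsetP => x.
    by move=> /(VP i _ WS) /andP[].
  have le_k : (#|` Y| + #|W|)%N <= k.
    by rewrite -cardYV -(Fk _ (iP i0).1) fsubset_leq_card // YVi.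
  have le_star : #|[set i | W \subset S i]| <= #|` star F (Y `|` V)|.
    apply: card_set_fset_le => i; rewrite inE => WS.
    by rewrite starP (iP i).1 YVi.
  apply: leq_trans (leq_mul le_star (leqnn _)) _.
  apply: leq_trans (leq_mul (Ymax _ _) (leqnn _)) _.
    by rewrite cardYV -[ltnLHS]addn0 ltn_add2l.
  rewrite cardYV -expnD subnDA subnK; last by rewrite leq_subRL // ltnW.
  by rewrite cardY ltnW.
have [|s sdis] := spread_disjoint p_gt0 _ Sk spread.
  by rewrite cardY; exact: leq_ltn_trans YF.
have mem_S (i : star F Y) x : x \in val i -> x \notin Y ->
    exists2 u : U, u \in S i & val u = x.
  move=> xi xY; have xU := fsubsetP (FU _ (iP i).1) x xi.
  by exists [` xU]; rewrite // !inE /= xY.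
have s_inj : injective (val \o s).
  move=> j j' /= /val_inj sE; apply/eqP; apply: contraT => /sdis; rewrite sE.
  have /fset0Pn[x] : val (s j') `\` Y != fset0.
    rewrite fsetD_eq0; apply/negP => /fsubset_leq_card.
    by rewrite Fk ?(iP _).1 // leqNgt Yk.
  rewrite inE => /andP[xY /mem_S/(_ xY)[u uS _]].
  by move=> /disjointFr/(_ uS); rewrite uS.
exists [fset (val \o s) j | j in 'I_p].
  by apply/fsubsetP => _ /imfsetP[j _ ->]; exact: (iP _).1.
split; first by rewrite card_imfset //= -[RHS]card_ord cardE.
have kernel j j' : val (s j) != val (s j') -> val (s j) `&` val (s j') = Y.
  move=> sjj'; apply/eqP; rewrite eqEfsubset fsubsetI !(iP _).2 !andbT.
  apply/fsubsetP => x; rewrite inE => /andP[xj xj'].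
  apply: contraT => xY.
  have [u uj ux] := mem_S _ _ xj xY; have [v vj' vx] := mem_S _ _ xj' xY.
  have /sdis/disjointFr/(_ uj) : j != j' by apply: contraNneq sjj' => ->.
  by rewrite (val_inj (etrans ux (esym vx))) vj'.
move=> _ _ _ _ /imfsetP[j _ ->] /imfsetP[j' _ ->] /imfsetP[l _ ->] /imfsetP[l' _ ->].
by move=> jj' ll' /=; rewrite !kernel.
Qed.

(* The bound in terms of the natural logarithm *)
Local Close Scope fset_scope.
Local Open Scope ring_scope.

(** From [2 ^ m <= k ^ 2] and [2^-1 <= ln 2] follows [m / 2 <= 2 * ln k]. *)
Lemma trunc_log2_le_ln (R : realType) (k : nat) : (2 <= k)%N ->
  (trunc_log 2 k).+1%:R <= 4 * ln k%:R :> R.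
Proof.
move=> k2; set m := (trunc_log 2 k).+1.
have k_gt0 : 0 < k%:R :> R by rewrite ltr0n; lia.
have half : 2^-1 <= ln 2 :> R.
  have : ln (1 + - 2^-1) <= - 2^-1 :> R by apply: le_ln1Dx; lra.
  rewrite (_ : 1 + - 2^-1 = 2^-1 :> R); last by lra.
  by rewrite lnV ?posrE // lerN2.
have : ln (2 ^+ m) <= ln (k%:R ^+ 2) :> R.
  rewrite ler_ln ?posrE ?exprn_gt0 // -!natrX ler_nat.
  rewrite /m expnS -mulnn leq_mul //; apply: trunc_logP => //; lia.
rewrite !lnXn // -[ln 2 *+ m]mulr_natl mulr2n => h.
have : m%:R * 2^-1 <= m%:R * ln 2 :> R by rewrite ler_wpM2l.
lra.
Qed.

Theorem theorem1 (R : realType) :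
  exists C : R, 4 <= C /\
    forall p k : nat, (2 <= p)%N -> (2 <= k)%N ->
      (Sun p k)%:R <= (C * p%:R * ln k%:R) ^+ k.
Proof.
(* [68 = 17 * 4]: passing from 16 to 17 absorbs the successor in [(16 * p * m).+1], and 4 comes from
   [m <= 4 * ln k]. *)
exists 68; split; first by rewrite ler_nat.
move=> p k p2 k2; set m := (trunc_log 2 k).+1.
have Sun_le : (Sun p k <= (16 * p * m).+1 ^ k)%N.
  rewrite /Sun; case: ex_minnP => n _ nmin; apply: (@leq_trans ((16 * p * m) ^ k).+1).
    by apply: nmin; apply/asboolP; apply: forces_sunflower_expn; lia.
  by rewrite ltn_exp2r //; lia.
apply: (@le_trans _ _ ((16 * p * m).+1 ^ k)%:R); first by rewrite ler_nat.
rewrite natrX lerXn2r ?nnegrE //.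
  by rewrite !mulr_ge0 ?ln_ge0 // ler1n; lia.
have le17 : ((16 * p * m).+1 <= 17 * p * m)%N.
  have : (0 < p * m)%N by rewrite muln_gt0 /m; lia.
  lia.
apply: (@le_trans _ _ (17 * p * m)%:R); first by rewrite ler_nat.
rewrite !natrM (_ : 68 * _ * _ = 17 * p%:R * (4 * ln k%:R) :> R); last by lra.
by apply: ler_wpM2l; [exact: mulr_ge0 | exact: trunc_log2_le_ln].
Qed.
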